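(* Let $n\ge 2$ be a fixed integer, let $\delta>0$ be fixed, and let $S$ be a real-valued source with finite variance $\sigma_S^2$ and a probability density $p_S$ such that there exist an interval $[A,B]$ with $A<B$ and a number $p_{\min}>0$ with $p_S(s)\ge p_{\min}$ for all $s\in[A,B]$. Consider the transmission strategy with $n$ channel uses described in the context. For any choice of the parameter $\beta=\beta(\mathrm{snr})>0$ as a function of $\mathrm{snr}$ with $\beta(\mathrm{snr})\to\infty$ as $\mathrm{snr}\to\infty$, and for any decoder producing an estimate $\hat S$ from the channel outputs $(Y_1,\dots,Y_n)$ (the decoder may depend on $\mathrm{snr}$), the mean squared error satisfies $$\mathbb{E}[(\hat S-S)^2]\in\Omega\big(\mathrm{snr}^{-n}(\log \mathrm{snr})^{n-1}\big).$$
   Context: Encoder. For $x\in\mathbb{R}$, $\mathrm{int}(x)$ denotes the unique integer $i$ with $x\in[i-\tfrac12,i+\tfrac12)$. Given $\beta>0$, set $E_0=S$ and recursively, for $i=1,\dots,n-1$, $$Q_i=\frac1\beta\,\mathrm{int}(\beta E_{i-1}),\qquad E_i=\beta(E_{i-1}-Q_i).$$ The channel inputs are $$X_i=\sqrt{\frac{P}{\sigma_S^2+\delta}}\,Q_i\quad(i=1,\dots,n-1),\qquad X_n=\sqrt{\frac{P}{\sigma_E^2}}\,E_{n-1},$$ where $P>0$, $\sigma_S^2=\mathrm{Var}(S)$, $\sigma_E^2=\mathrm{Var}(E_{n-1})$, and $\delta>0$ is a fixed constant. Channel. $Y_i=X_i+Z_i$ for $i=1,\dots,n$, where $Z_1,\dots,Z_n$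 are i.i.d. zero-mean Gaussian random variables of variance $\sigma_Z^2>0$, independent of $S$. The signal-to-noise ratio is $\mathrm{snr}=P/\sigma_Z^2$. The scaling factor $\beta$ is a function of $\mathrm{snr}$ that grows with $\mathrm{snr}$. Decoder. A decoder is a (measurable) map producing an estimate $\hat S$ of $S$ from $(Y_1,\dots,Y_n)$. Asymptotic notation. $f(x)\in\Omega(g(x))$ means that there exist $x_0$ and a constant $c>0$ such that $f(x)\ge c\,g(x)$ for all $x>x_0$; here the variable is $x=\mathrm{snr}$. *)

(* Defs.v *)
From HB Require Import structures.
From mathcomp Require Import all_boot all_order all_algebra.
From mathcomp Require Import all_classical all_reals all_analysis.
From mathcomp Require Import lra.

Set Implicit Arguments.
Unset Strict Implicit.
Unset Printing Implicit Defensive.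

Import Order.TTheory GRing.Theory Num.Theory.
Import numFieldNormedType.Exports.

Local Open Scope classical_set_scope.
Local Open Scope ring_scope.

Definition has_density d (T : measurableType d) (R : realType)
    (Pr : probability T R) (X : {RV Pr >-> R}) (p : R -> R) : Prop :=
  [/\ measurable_fun setT p,
      (forall x, 0 <= p x) &
      forall A : set R, measurable A ->
        distribution Pr X A = (\int[lebesgue_measure]_(x in A) (p x)%:E)%E].

Definition independent d d1 d2 (T : measurableType d) (T1 : measurableType d1)
    (T2 : measurableType d2) (R : realType) (Pr : probability T R)
    (X : T -> T1) (Y : T -> T2) : Prop :=
  forall (A : set T1) (B : set T2), measurable A -> measurable B ->
    Pr (X @^-1` A `&` Y @^-1` B) = (Pr (X @^-1` A) * Pr (Y @^-1` B))%E.

Definition mutually_independent d d' (T : measurableType d)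
    (T' : measurableType d') (R : realType) (Pr : probability T R)
    (I : finType) (X : I -> T -> T') : Prop :=
  forall (J : {set I}) (A : I -> set T'),
    (forall i, i \in J -> measurable (A i)) ->
    Pr (\bigcap_(i in [set` J]) (X i @^-1` A i)) =
    (\prod_(i in J) Pr (X i @^-1` A i))%E.

(** [Z i] is the noise of the [i.+1]-st channel use; [sigma] is the standard
    deviation. *)
Definition iid_gaussian_noise d (T : measurableType d) (R : realType)
    (Pr : probability T R) (n : nat) (sigma : R)
    (Z : 'I_n -> {RV Pr >-> R}) : Prop :=
  mutually_independent Pr (fun i => Z i : T -> R) /\
  forall (i : 'I_n) (A : set R), measurable A ->
    distribution Pr (Z i) A = normal_prob 0 sigma A.

Definition in_Omega (R : realType) (f : R -> \bar R) (g : R -> R) : Prop :=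
  exists x0 c : R, 0 < c /\ forall x, x0 < x -> ((c * g x)%:E <= f x)%E.

Definition nearest_int (R : realType) (x : R) : int := Num.floor (x + 2^-1).

(** The defining property of the rounding: ties are rounded up. *)
Lemma nearest_intP (R : realType) (x : R) (i : int) :
  reflect (i%:~R - 2^-1 <= x < i%:~R + 2^-1) (nearest_int x == i).
Proof.
rewrite /nearest_int floor_eq intrD.
by apply: (iffP andP) => [[? ?]|/andP[? ?]]; [apply/andP|]; split; lra.
Qed.

Definition quantize (R : realType) (beta e : R) : R :=
  beta^-1 * (nearest_int (beta * e))%:~R.

(** [residual beta s i] is E_i for the source value [s]. *)
Fixpoint residual (R : realType) (beta s : R) (i : nat) : R :=
  if i is j.+1 then
    beta * (residual beta s j - quantize beta (residual beta s j))
  else s.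

(** [quantized beta s i] is Q_i, meaningful for [0 < i] only. *)
Definition quantized (R : realType) (beta s : R) (i : nat) : R :=
  quantize beta (residual beta s i.-1).

(** X_i for [1 <= i <= n] and the source value [s]. *)
Definition channel_input (R : realType) (n : nat) (P varS delta varE beta s : R)
    (i : nat) : R :=
  if i == n then Num.sqrt (P / varE) * residual beta s n.-1
  else Num.sqrt (P / (varS + delta)) * quantized beta s i.

(** The vector (Y_1, ..., Y_n); its component of index [i : 'I_n] is
    Y_(i+1). *)
Definition channel_output d (T : measurableType d) (R : realType)
    (Pr : probability T R) (n : nat) (S : {RV Pr >-> R}) (P delta beta : R)
    (Z : 'I_n -> {RV Pr >-> R}) (w : T) : n.-tuple R :=
  let varS := fine 'V_Pr[S] in
  let varE := fine 'V_Pr[fun w' => residual beta (S w') n.-1] in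
  [tuple channel_input n P varS delta varE beta (S w) i.+1 + Z i w | i < n].

Definition mse d (T : measurableType d) (R : realType)
    (Pr : probability T R) (S Shat : T -> R) : \bar R :=
  'E_Pr[fun w => (Shat w - S w) ^+ 2].

(* Main.v *)
(** Two instances of Le Cam's two-point argument. If the sources [s] and [s + t]
    give channel inputs that differ in one coordinate only, by [Delta] noise
    standard deviations, then translating the Gaussian noise of that channel use
    makes their outputs coincide, and the mean squared error is at least a
    constant times [t ^ 2 * exp (- Delta ^ 2)].
    - If [beta ^ 2 <= K snr / ln snr], take [t] of order
      [snr ^ (-1/2) / beta ^ (n - 1)]: for a positive fraction of the sources all
      the quantized values are unchanged, only the last channel input moves, and
      [Delta <= 1] because the variance of [E_(n-1)] is bounded below. This gives
      the order [snr ^ (-n) (ln snr) ^ (n - 1)].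
    - Otherwise take [t = j / beta] with [j] an integer and [t] of order
      [snr ^ (-1/2) + beta ^ (-1)]: only [Q_1] moves, [Delta ^ 2] is at most
      [ln snr / 2] up to a constant, and the error is at least of order
      [snr ^ (-3/2)]. *)

Require Import Defs.
From HB Require Import structures.
From mathcomp Require Import all_boot all_order all_algebra.
From mathcomp Require Import all_classical all_reals all_analysis.
From mathcomp Require Import measurable_realfun.
From mathcomp Require Import ring lra zify.

Set Implicit Arguments.
Unset Strict Implicit.
Unset Printing Implicit Defensive.

Import Order.TTheory GRing.Theory Num.Theory.
Import numFieldNormedType.Exports.

Local Open Scope classical_set_scope.
Local Open Scope ring_scope.

(** * Comparison of measures and translations of the Lebesgue measure *)

(** Restricting [m1] to [D] and scaling it by [c] gives a measure below [m2], and integrals of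
    nonnegative functions are monotone in the measure. This lets a law be replaced by a multiple of
    the Lebesgue measure on a set where its density is bounded below. *)
Lemma minorized_integral d (T : measurableType d) (R : realType)
    (m1 m2 : {measure set T -> \bar R}) (c : R) (D : set T) (f : T -> \bar R) :
  0 <= c -> measurable D ->
  (forall A, measurable A -> (c%:E * m1 (A `&` D) <= m2 A)%E) ->
  measurable_fun setT f -> (forall x, (0 <= f x)%E) ->
  (c%:E * \int[m1]_(x in D) f x <= \int[m2]_x f x)%E.
Proof.
move=> c0 mD m12 mf f0.
have mfD : measurable_fun D f by exact: measurable_funTS.
have -> : (\int[m1]_(x in D) f x = \int[mrestr m1 mD]_(x in D) f x)%E.
  by apply: eq_measure_integral => A mA AD; rewrite /= /mrestr setIidl.
rewrite -(@ge0_integral_mscale _ _ _ _ _ mD (NngNum c0))//.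
apply: (@le_trans _ _ (\int[m2]_(x in D) f x)%E).
  by apply: ge0_le_measure_integral.
exact: ge0_subset_integral.
Qed.

(** By uniqueness of the Lebesgue measure: [a] times its pushforward under the affine map gives
    half-open intervals their length. *)
Lemma lebesgue_measure_affine (R : realType) (a b : R) (A : set R) : 0 < a ->
  measurable A ->
  lebesgue_measure ((fun x => a * x + b) @^-1` A) =
    (a^-1%:E * lebesgue_measure A)%E.
Proof.
move=> a0 mA; pose f (x : measurableTypeR R) : measurableTypeR R := a * x + b.
have mf : measurable_fun setT f.
  by apply: measurable_funD => //; exact: measurable_funM.
pose k := NngNum (ltW a0).
have scaled : mscale k (pushforward lebesgue_measure f) A = lebesgue_measure A.
  move=> ?; apply/esym/lebesgue_measure_unique => //= _ [[l r] _ <-].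
  rewrite /mscale/= /pushforward.
  have -> : f @^-1` `]l, r] = `](l - b) / a, (r - b) / a]%classic.
    apply/seteqP; split=> x /=; rewrite !in_itv/= /f ltr_pdivrMr// ler_pdivlMr//;
    by rewrite ltrBlDr lerBrDr mulrC.
  rewrite !lebesgue_measure_itv/= !lte_fin ltr_pM2r ?invr_gt0// ltrD2r.
  case: ifPn => _; last by rewrite mule0.
  by rewrite -!EFinB -EFinM; congr EFin; field; rewrite gt_eqF.
by rewrite -(scaled mf) /mscale/= /pushforward muleA -EFinM mulVf ?gt_eqF// mul1e.
Qed.

Lemma lebesgue_measure_shift (R : realType) (t : R) (A : set R) :
  measurable A ->
  lebesgue_measure ((fun x => x + t) @^-1` A) = lebesgue_measure A.
Proof.
move=> mA; rewrite -[RHS]mul1e -[X in (X%:E * _)%E]invr1.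
rewrite -(lebesgue_measure_affine t)//.
by congr lebesgue_measure; apply/seteqP; split=> x /=; rewrite mul1r.
Qed.

Lemma le_integral_shift (R : realType) (t : R) (D E : set R) (f : R -> \bar R) :
  measurable D -> measurable E -> (forall x, D x -> E (x + t)) ->
  measurable_fun setT f -> (forall x, (0 <= f x)%E) ->
  (\int[lebesgue_measure]_(x in D) f (x + t)%R <=
   \int[lebesgue_measure]_(x in E) f x)%E.
Proof.
move=> mD mE DE mf f0.
pose sh (x : measurableTypeR R) : measurableTypeR R := x + t.
have mtt : measurable_fun setT sh by exact: measurable_funD.
have <- : (\int[lebesgue_measure]_(x in sh @^-1` E) (f \o sh) x =
           \int[lebesgue_measure]_(x in E) f x)%E.
  rewrite -ge0_integral_pushforward//; last exact: measurable_funTS.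
  by apply: eq_measure_integral => A mA _; exact: lebesgue_measure_shift.
apply: ge0_subset_integral => //.
- by rewrite -[X in measurable X]setTI; exact: mtt.
- by apply: measurable_funTS; exact: measurableT_comp.
Qed.

(** * Rounding and residuals: bounds and measurability *)

Lemma residualS (R : realType) (beta s : R) (i : nat) : 0 < beta ->
  residual beta s i.+1 =
    beta * residual beta s i - (nearest_int (beta * residual beta s i))%:~R.
Proof. by move=> b0; rewrite /= mulrBr mulrA mulfV ?gt_eqF// mul1r. Qed.

Lemma nearest_int_itv (R : realType) (x : R) :
  (nearest_int x)%:~R - 2^-1 <= x < (nearest_int x)%:~R + 2^-1.
Proof. exact/nearest_intP. Qed.

Lemma nearest_intDz (R : realType) (x : R) (i : int) :
  nearest_int (x + i%:~R) = nearest_int x + i.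
Proof.
apply/eqP/nearest_intP; rewrite intrD.
by have /andP[? ?] := nearest_int_itv x; apply/andP; split; lra.
Qed.

Lemma residualS_itv (R : realType) (beta s : R) (i : nat) : 0 < beta ->
  - 2^-1 <= residual beta s i.+1 < 2^-1.
Proof.
move=> b0; rewrite residualS//.
have /andP[] := nearest_int_itv (beta * residual beta s i).
by move=> ? ?; apply/andP; split; lra.
Qed.

Lemma measurable_nearest_int (R : realType) :
  measurable_fun setT (fun x : R => (nearest_int x)%:~R : R).
Proof.
apply: nondecreasing_measurable => // x y xy.
by rewrite ler_int; apply: le_floor; rewrite lerD2r.
Qed.

Lemma measurable_quantize (R : realType) (beta : R) :
  measurable_fun setT (quantize beta).
Proof.
apply: measurable_funM => //.
apply: (measurableT_comp (@measurable_nearest_int R)).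
exact: measurable_funM.
Qed.

Lemma measurable_residual (R : realType) (beta : R) (i : nat) :
  measurable_fun setT (fun s => residual beta s i).
Proof.
elim: i => [|i IHi] /=; first exact: measurable_id.
apply: measurable_funM => //; apply: measurable_funB => //.
exact: (measurableT_comp (@measurable_quantize R beta)).
Qed.

Lemma measurable_quantized (R : realType) (beta : R) (i : nat) :
  measurable_fun setT (fun s => quantized beta s i).
Proof.
apply: (measurableT_comp (@measurable_quantize R beta)).
exact: measurable_residual.
Qed.

(** * Spreading of the residuals over the rounding cell, uniformly in [beta] *)

Lemma measurable_rounding_error (R : realType) (beta : R) :
  measurable_fun setT (fun e => beta * e - (nearest_int (beta * e))%:~R).
Proof.
apply: measurable_funB; first exact: measurable_funM.
by apply: (measurableT_comp (@measurable_nearest_int R)); exact: measurable_funM.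
Qed.

(* At least [beta (b - a) / 2] full rounding cells, each of length [beta^-1],
   lie in [a, b[, and the rounding error maps each of them affinely onto
   [-1/2, 1/2[. *)
Lemma rounding_error_minorized (R : realType)
    (nu : {measure set (measurableTypeR R) -> \bar R}) (c a b beta : R) :
  0 <= c -> 0 < beta -> 4 <= beta * (b - a) ->
  (forall A, measurable A ->
    (c%:E * lebesgue_measure (A `&` `[a, b[) <= nu A)%E) ->
  forall A : set R, measurable A ->
    ((c * (b - a) / 2)%:E * lebesgue_measure (A `&` `[(- 2^-1)%R, (2^-1)%R[) <=
     nu ((fun e => (beta * e - (nearest_int (beta * e))%:~R)%R) @^-1` A))%E.
Proof.
move=> c0 b0 bab nuP A mA.
pose f (e : R) : R := beta * e - (nearest_int (beta * e))%:~R.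
have mf : measurable_fun setT f by exact: measurable_rounding_error.
pose I : set R := `[- 2^-1, 2^-1[%classic.
have mAI : measurable (A `&` I) by apply: measurableI => //; exact: measurable_itv.
pose x := beta * (b - a).
(* In the variable [beta * e] the cells have length 1 and the interval has length [x]. Aligning to
   the first full cell wastes less than 1, hence [x - 1]; from [4 <= x] follows
   [N > x - 2 >= x / 2]. *)
pose N := Num.truncn (x - 1).
have /andP[N1 N2] : N%:R <= x - 1 < N.+1%:R.
  by apply: truncn_itv; rewrite /x; lra.
rewrite -natr1 in N2.
(* The leftmost cell [[k0 - 1/2, k0 + 1/2[] that starts at or after [beta * a]. *)
pose k0 := Num.ceil (beta * a + 2^-1).
have /andP[k1 k2] := ceil_itv (beta * a + 2^-1).
rewrite -/k0 intrB in k1 k2.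
(* On the cell of [k0 + j] the rounding error is the affine map [g j]; [F j] is the part of that
   cell sent into [A]. *)
pose g j (e : R) : R := beta * e + - (k0 + j%:Z)%:~R.
pose F j := g j @^-1` (A `&` I).
have mF j : measurable (F j).
  rewrite -[F j]setTI; apply: (_ : measurable_fun setT (g j)) => //.
  by apply: measurable_funD => //; exact: measurable_funM.
have muF j : lebesgue_measure (F j) = (beta^-1%:E * lebesgue_measure (A `&` I))%E.
  exact: lebesgue_measure_affine.
have nearF j e : F j e -> nearest_int (beta * e) = k0 + j%:Z.
  rewrite /F/= /I/= in_itv/= /g => -[_ /andP[h1 h2]].
  by apply/eqP/nearest_intP; apply/andP; split; lra.
have tF : trivIset `I_N F.
  move=> i j _ _ [e [/nearF + /nearF]] => -> /eqP.
  by rewrite (inj_eq (addrI _)) => /eqP[].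
have Fab j : (j < N)%N -> F j `<=` `[a, b[%classic.
  move=> jN e; rewrite /F/= /I/= in_itv/= /g intrD => -[_ /andP[h1 h2]].
  have jN' : (j%:Z)%:~R + 1 <= N%:R :> R.
    by rewrite -[(j%:Z)%:~R]/(j%:R) natr1 ler_nat.
  have j0 : 0 <= (j%:Z)%:~R :> R by rewrite -[(j%:Z)%:~R]/(j%:R).
  rewrite in_itv/= -(ler_pM2l b0) -(ltr_pM2l b0).
  by rewrite /x in N1; apply/andP; split; lra.
have Ff j : F j `<=` f @^-1` A.
  by move=> e Fe; have [Ae _] := Fe; rewrite /f/= (nearF _ _ Fe).
apply: (@le_trans _ _ (nu (\big[setU/set0]_(j < N) F j))); last first.
  apply: le_measure; rewrite ?inE.
  - by apply: bigsetU_measurable => j _; exact: mF.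
  - by rewrite -[X in measurable X]setTI; exact: mf.
  - rewrite -bigcup_mkord; by apply: bigcup_sub => j _; exact: Ff.
rewrite measure_semi_additive_ord_I//; last 2 first.
- by move=> j _; exact: mF.
- by apply: bigsetU_measurable => j _; exact: mF.
apply: (@le_trans _ _ (\sum_(j < N) c%:E * lebesgue_measure (F j))%E); last first.
  apply: lee_sum => j _; apply: le_trans (nuP _ (mF j)).
  by rewrite setIidl//; exact: Fab.
have : lebesgue_measure (A `&` I) \is a fin_num.
  rewrite ge0_fin_numE//.
  apply: (@le_lt_trans _ _ (lebesgue_measure I)).
    by apply: le_measure; rewrite ?inE//; exact: measurable_itv.
  by rewrite /I lebesgue_measure_itv/=; case: ifPn; rewrite -?EFinB ltry.
move=> /fineK muE.
under eq_bigr do rewrite muF.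
rewrite -/I -muE; set r := fine _.
have r0 : 0 <= r by exact: fine_ge0.
rewrite sumEFin sumr_const card_ord -EFinM lee_fin -[leRHS]mulr_natr.
have -> : c * (b - a) / 2 * r = c * (beta^-1 * r) * (x / 2).
  by rewrite /x; field; rewrite gt_eqF.
apply: ler_wpM2l; last by rewrite /x in N2 *; lra.
by rewrite !mulr_ge0// invr_ge0 ltW.
Qed.

(* The margin [1/4] below the upper end [1/2] of the rounding cell leaves room
   for an increase of [s] that changes no quantized value. *)
Fixpoint slack_set (R : realType) (beta a b : R) (i : nat) : set R :=
  if i is j.+1 then
    slack_set beta a b j `&` [set s | residual beta s j.+1 < 4^-1]
  else `[a, b[.

Lemma slack_set_itv (R : realType) (beta a b s : R) (i : nat) :
  slack_set beta a b i s -> a <= s < b.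
Proof. by elim: i => [|i IHi] /=; [rewrite in_itv|move=> [/IHi]]. Qed.

Lemma slack_set_residual (R : realType) (beta a b s : R) (i j : nat) :
  slack_set beta a b i s -> (j < i)%N -> residual beta s j.+1 < 4^-1.
Proof.
elim: i => [//|i IHi] [si ri]; rewrite ltnS leq_eqVlt => /predU1P[->//|].
exact: IHi.
Qed.

Lemma measurable_slack_set (R : realType) (beta a b : R) (i : nat) :
  measurable (slack_set beta a b i).
Proof.
elim: i => [|i IHi]; first exact: measurable_itv.
apply: measurableI => //.
have -> : [set s | residual beta s i.+1 < 4^-1] =
    (fun s => residual beta s i.+1) @^-1` `]-oo, 4^-1[.
  by apply/seteqP; split=> s /=; rewrite in_itv.
by rewrite -[X in measurable X]setTI; apply: measurable_residual.
Qed.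

(** Induction on [i]: one more encoding step is one more rounding error, so the lower bound persists
    at the price of a factor [(v - u) / 2]. The interval [[u, v[] is left free because it is [[a,
    b[] at the start and [[-1/2, 1/4[] afterwards. What matters is that [c] does not depend on
    [beta]. *)
Lemma residual_minorized_aux (R : realType) (a b : R) (i : nat) : a < b ->
  exists c u v K : R, [/\ 0 < c, u < v, (0 < i)%N -> u = - 2^-1 /\ v = 4^-1 &
    forall beta, 0 < beta -> K <= beta -> forall A : set R, measurable A ->
      (c%:E * lebesgue_measure (A `&` `[u, v[) <= lebesgue_measure
         ((fun s => residual beta s i) @^-1` A `&` slack_set beta a b i))%E].
Proof.
move=> ab; elim: i => [|i [c [u [v [K [c0 uv _ IHi]]]]]].
  exists 1, a, b, 0; split=> // beta _ _ A mA.
  by rewrite mul1e.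
(* The bound [4 / (v - u)] on [beta] ensures that [[u, v[] is at least four cells long. *)
exists (c * (v - u) / 2), (- 2^-1), 4^-1, (Num.max K (4 / (v - u))).
have uv0 : 0 < v - u by rewrite subr_gt0.
split=> //; [by rewrite divr_gt0// mulr_gt0|lra|].
move=> beta b0; rewrite ge_max => /andP[Kb ub] A mA.
pose J : set R := `[- 2^-1, 4^-1[%classic.
have mJ : measurable J by exact: measurable_itv.
pose mG := measurable_slack_set beta a b i.
pose res (s : measurableTypeR R) : measurableTypeR R := residual beta s i.
have mres : measurable_fun setT res by exact: measurable_residual.
(* The law of the [i]-th residual when the source ranges over the slack set with the Lebesgue
   measure. *)
pose nu := measure_function_pushforward__canonical__measure_function_Measure
  (mrestr lebesgue_measure mG) mres.
(* Testing on the intersection of [A] and [J] keeps only the sources whose next residual is below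
   1/4, which are those of the next slack set. *)
have := @rounding_error_minorized R nu c u v beta (ltW c0) b0 _ (IHi beta b0 Kb)
  (A `&` J) (measurableI _ _ mA mJ).
rewrite -ler_pdivrMr// => /(_ ub).
have -> : A `&` J `&` `[- 2^-1, 2^-1[ = A `&` J.
  rewrite setIidl// => s [_]; rewrite /J/= !in_itv/= => /andP[-> ?] /=.
  by lra.
move=> /le_trans; apply.
rewrite /nu/= /pushforward /mrestr; apply: le_measure; rewrite ?inE.
- apply: measurableI => //; rewrite -[X in measurable X]setTI.
  apply: (mres measurableT); rewrite -[X in measurable X]setTI.
  by apply: measurable_rounding_error => //; exact: measurableI.
- apply: measurableI; last exact: (measurable_slack_set beta a b i.+1).
  by rewrite -[X in measurable X]setTI; apply: (measurable_residual beta i.+1).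
- move=> s [[]]; rewrite /res -residualS// => As Js Gs.
  by split=> //; split=> //; move: Js; rewrite /J/= in_itv/= => /andP[].
Qed.

Lemma residual_minorized (R : realType) (a b : R) (i : nat) : a < b ->
  exists c K : R, 0 < c /\
    forall beta, 0 < beta -> K <= beta -> forall A : set R, measurable A ->
      (c%:E * lebesgue_measure (A `&` `[(- 2^-1)%R, (4^-1)%R[) <= lebesgue_measure
         ((fun s => residual beta s i.+1) @^-1` A `&` slack_set beta a b i.+1))%E.
Proof.
move=> /(residual_minorized_aux i.+1)[c [u [v [K [c0 _ /(_ isT)[-> ->] H]]]]].
by exists c, K.
Qed.

Lemma slack_set_measure_ge (R : realType) (a b : R) (i : nat) : a < b ->
  exists c K : R, 0 < c /\ forall beta, 0 < beta -> K <= beta ->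
    (c%:E <= lebesgue_measure (slack_set beta a b i))%E.
Proof.
move=> ab; have [c [u [v [K [c0 uv _ H]]]]] := residual_minorized_aux i ab.
exists (c * (v - u)), K; split; first by rewrite mulr_gt0// subr_gt0.
move=> beta b0 Kb; have := H beta b0 Kb setT measurableT.
by rewrite preimage_setT !setTI lebesgue_measure_itv/= lte_fin uv -EFinB -EFinM.
Qed.

(** * Consequences of a density bounded below: variance of the residual, integrals over translated
    pairs *)

Lemma integral_minorized (R : realType) (p : R -> R) (a b m : R) (A : set R) :
  measurable_fun setT p -> (forall x, 0 <= p x) -> 0 <= m ->
  (forall x, a <= x <= b -> m <= p x) -> measurable A ->
  (m%:E * lebesgue_measure (A `&` `[a, b]) <=
   \int[lebesgue_measure]_(x in A) (p x)%:E)%E.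
Proof.
move=> mp p0 m0 mp' mA.
have mI : measurable (A `&` `[a, b]).
  by apply: measurableI => //; exact: measurable_itv.
apply: (@le_trans _ _ (\int[lebesgue_measure]_(x in A `&` `[a, b]) (p x)%:E)%E).
  rewrite -integral_cst//; apply: ge0_le_integral => //.
  - by apply/measurable_EFinP; exact: measurable_funTS.
  - by move=> x [_] /=; rewrite in_itv/= lee_fin => /mp'.
apply: ge0_subset_integral => //.
  by apply/measurable_EFinP; exact: measurable_funTS.
by move=> x _; rewrite lee_fin.
Qed.

Lemma density_minorized d (T : measurableType d) (R : realType)
    (Pr : probability T R) (X : {RV Pr >-> R}) (p : R -> R) (a b m : R) :
  has_density X p -> 0 <= m -> (forall x, a <= x <= b -> m <= p x) ->
  forall A, measurable A ->
    (m%:E * lebesgue_measure (A `&` `[a, b]) <= distribution Pr X A)%E.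
Proof.
by move=> [mp p0 pE] m0 mp' A mA; rewrite pE//; exact: integral_minorized.
Qed.

(** Since [fine] sends infinity to 0, a lower bound on a variance passes to its [fine] part only
    once finiteness is known. *)
Lemma bounded_variance_fin_num d (T : measurableType d) (R : realType)
    (Pr : probability T R) (X : T -> R) (M : R) :
  measurable_fun setT X -> (forall w, `|X w| <= M) -> 'V_Pr[X]%E \is a fin_num.
Proof.
move=> mX XM; rewrite ge0_fin_numE ?variance_ge0// /variance unlock.
set m := fine _; rewrite unlock.
apply: (@le_lt_trans _ _ (\int[Pr]_w (cst ((M + `|m|) ^+ 2)%:E w))%E).
  apply: ge0_le_integral => //=.
  - by move=> w _; rewrite lee_fin -expr2 sqr_ge0.
  - apply/measurable_EFinP; apply: measurable_funM; exact: measurable_funB.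
  - move=> w _; rewrite lee_fin -expr2 -[leLHS]/((X w - m) ^+ 2).
    rewrite -[leLHS]real_normK ?num_real//.
    apply: lerXn2r; rewrite ?nnegrE ?addr_ge0//.
      by rewrite (le_trans (normr_ge0 (X w))).
    by rewrite (le_trans (ler_normB _ _))// lerD2r.
by rewrite integral_cst//= probability_setT mule1 ltry.
Qed.

(** Chebyshev's inequality read backwards: the residual charges every subinterval of [[-1/2, 1/4[],
    so wherever its mean lies, it stays at distance at least 1/8 from it with a probability bounded
    below. *)
Lemma variance_residual_ge d (T : measurableType d) (R : realType)
    (Pr : probability T R) (S : {RV Pr >-> R}) (pS : R -> R) (a b m : R)
    (i : nat) :
  has_density S pS -> a < b -> 0 < m -> (forall s, a <= s <= b -> m <= pS s) ->
  exists v K : R, 0 < v /\ forall beta, 0 < beta -> K <= beta ->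
    v <= fine 'V_Pr[fun w => residual beta (S w) i.+1]%E.
Proof.
move=> hS ab m0 hp; have [c [K [c0 cP]]] := residual_minorized i ab.
(* [m * c * 4^-1] bounds below the probability of an interval of length 1/4, and [8^-1 ^+ 2] is the
   squared Chebyshev threshold. *)
exists (m * c * 4^-1 * 8^-1 ^+ 2), K; split.
  by rewrite !mulr_gt0// exprn_gt0.
move=> beta b0 Kb.
have mX : measurable_fun setT (fun w => residual beta (S w) i.+1).
  exact: (measurableT_comp (measurable_residual beta i.+1)).
have XM w : `|residual beta (S w) i.+1| <= 2^-1.
  by rewrite ler_norml; have /andP[-> /ltW] := residualS_itv (S w) i b0.
have Vfin := bounded_variance_fin_num Pr mX XM.
pose fX := isMeasurableFun.Build _ _ _ _ _ mX.
pose X : {RV Pr >-> R} := HB.pack (fun w => residual beta (S w) i.+1) fX.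
rewrite -lee_fin fineK//.
have e0 : 0 < 8^-1 :> R by [].
have := chebyshev X e0.
rewrite -lee_pdivrMl ?invr_gt0 ?exprn_gt0// invrK => /(le_trans _); apply.
rewrite [in leRHS]muleC mulrC EFinM [leRHS]muleC lee_pmul2l ?lte_fin ?exprn_gt0//.
set mu := fine _.
(* The interval is [[-1/2, -1/4[] if the mean exceeds -1/8, and [[0, 1/4[] otherwise. *)
have [u [uC uI]] : exists u : R, (forall x, u <= x < u + 4^-1 ->
    8^-1 <= `|x - mu|) /\
    `[u, u + 4^-1[%classic `<=` (`[- 2^-1, 4^-1[%classic : set R).
  have [mu_lt|mu_ge] := ltP (- 8^-1) mu.
    exists (- 2^-1); split.
      by move=> x /andP[? ?]; rewrite ler0_norm; lra.
    by move=> x /=; rewrite !in_itv/= => /andP[? ?]; apply/andP; split; lra.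
  exists 0; split.
    by move=> x /andP[? ?]; rewrite ger0_norm; lra.
  by move=> x /=; rewrite !in_itv/= => /andP[? ?]; apply/andP; split; lra.
pose C : set R := `[u, u + 4^-1[%classic.
have mC : measurable C by exact: measurable_itv.
have mrC : measurable ((fun s => residual beta s i.+1) @^-1` C).
  by rewrite -[X in measurable X]setTI; apply: (measurable_residual beta i.+1).
apply: (@le_trans _ _ (distribution Pr S
    ((fun s => residual beta s i.+1) @^-1` C))); last first.
  rewrite /distribution /pushforward; apply: le_measure; rewrite ?inE.
  - by rewrite -[X in measurable X]setTI; apply: measurable_funP.
  - have -> : [set x | 8^-1 <= `|X x - mu|] =
        (fun x => `|X x - mu|) @^-1` `[8^-1, +oo[.
      by apply/seteqP; split=> x /=; rewrite in_itv/= andbT.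
    rewrite -[X in measurable X]setTI.
    have : measurable_fun setT (fun x => `|X x - mu|).
      by apply: measurableT_comp => //; exact: measurable_funB.
    by apply=> //; exact: measurable_itv.
  - by move=> w /= Cw; apply: uC; move: Cw; rewrite /C/= in_itv.
apply: le_trans (density_minorized hS (ltW m0) hp mrC).
have := cP beta b0 Kb C mC; rewrite setIidl//.
have -> : lebesgue_measure C = 4^-1%:E.
  rewrite lebesgue_measure_itv/= lte_fin ifT; last by lra.
  by rewrite -EFinB; congr EFin; lra.
rewrite -mulrA EFinM lee_pmul2l ?lte_fin// => /le_trans; apply.
apply: le_measure; rewrite ?inE.
- by apply: measurableI => //; exact: (measurable_slack_set beta a b i.+1).
- by apply: measurableI => //; exact: measurable_itv.
- move=> s [Cs /slack_set_itv/andP[as_ sb]]; split=> //=.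
  by rewrite in_itv/= as_ ltW.
Qed.

(* [R] and [measurableTypeR R], on which the Lebesgue measure lives, have the
   same measurable sets but different displays, so a measure on the former does
   not have the type of a measure on the latter. *)
Lemma lebesgue_minorized_integral (R : realType) (nu : {measure set R -> \bar R})
    (c : R) (D : set R) (f : R -> \bar R) :
  0 <= c -> measurable D ->
  (forall A, measurable A -> (c%:E * lebesgue_measure (A `&` D) <= nu A)%E) ->
  measurable_fun setT f -> (forall x, (0 <= f x)%E) ->
  (c%:E * \int[lebesgue_measure]_(x in D) f x <= \int[nu]_x f x)%E.
Proof.
move=> c0 mD nuP mf f0; pose j (x : measurableTypeR R) : R := x.
have mj : measurable_fun setT j by exact: measurable_id.
pose lam := measure_function_pushforward__canonical__measure_function_Measure
  lebesgue_measure mj.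
have := @minorized_integral _ _ _ lam nu c D f c0 mD nuP mf f0.
by rewrite /lam ge0_integral_pushforward//; exact: measurable_funTS.
Qed.

(** Both integrals dominate [q] times a Lebesgue integral over [J]; translating the second by [a]
    brings the two over the common domain [D], where the sum of the integrands is at least [e]. It
    serves twice: for the noise of one channel use and for the source. *)
Lemma shifted_pair_integral_ge (R : realType)
    (nu : {measure set R -> \bar R}) (q a e : R)
    (D J : set R) (F1 F2 : R -> \bar R) :
  0 <= q -> 0 <= e -> measurable D -> measurable J ->
  (forall x, D x -> J x /\ J (x + a)) ->
  (forall A, measurable A -> (q%:E * lebesgue_measure (A `&` J) <= nu A)%E) ->
  measurable_fun setT F1 -> (forall x, (0 <= F1 x)%E) ->
  measurable_fun setT F2 -> (forall x, (0 <= F2 x)%E) ->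
  (forall x, D x -> (e%:E <= F1 x + F2 (x + a)%R)%E) ->
  ((q * e)%:E * lebesgue_measure D <= \int[nu]_x F1 x + \int[nu]_x F2 x)%E.
Proof.
move=> q0 e0 mD mJ DJ nuP mF1 F10 mF2 F20 eF.
have mF2a : measurable_fun D (fun x : measurableTypeR R => F2 (x + a)).
  apply: measurable_funTS; apply: (measurableT_comp mF2).
  exact: measurable_funD.
apply: (@le_trans _ _ (q%:E * (\int[lebesgue_measure]_(x in J) F1 x) +
    q%:E * (\int[lebesgue_measure]_(x in J) F2 x))%E); last first.
  by apply: leeD; apply: lebesgue_minorized_integral.
rewrite -ge0_muleDr ?integral_ge0// EFinM -muleA lee_wpmul2l ?lee_fin//.
apply: (@le_trans _ _ (\int[lebesgue_measure]_(x in D) F1 x +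
    \int[lebesgue_measure]_(x in D) F2 (x + a)%R)%E); last first.
  apply: leeD.
    apply: ge0_subset_integral => //; first exact: measurable_funTS.
    by move=> x /DJ[].
  by apply: le_integral_shift => // x /DJ[].
rewrite -ge0_integralD//; last exact: measurable_funTS.
rewrite -integral_cst//; apply: ge0_le_integral => //.
by apply: emeasurable_funD => //; exact: measurable_funTS.
Qed.

(** * Independence and product laws *)

(** Independence makes the joint law agree with the product law on rectangles, hence everywhere;
    Tonelli's theorem does the rest. *)
Lemma integral_independent d d1 d2 (T : measurableType d)
    (T1 : measurableType d1) (T2 : measurableType d2) (R : realType)
    (Pr : probability T R) (X : {RV Pr >-> T1}) (Y : {RV Pr >-> T2})
    (f : T1 * T2 -> \bar R) :
  independent Pr X Y -> measurable_fun setT f -> (forall z, (0 <= f z)%E) ->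
  (\int[Pr]_w f (X w, Y w) =
   \int[distribution Pr X]_x \int[distribution Pr Y]_y f (x, y))%E.
Proof.
move=> XY mf f0.
have mXY : measurable_fun setT (fun w => (X w, Y w)).
  by apply: measurable_fun_pair => //; exact: measurable_funP.
pose fXY := isMeasurableFun.Build _ _ _ _ _ mXY.
pose U : {RV Pr >-> (T1 * T2)%type} := HB.pack (fun w => (X w, Y w)) fXY.
rewrite -[LHS]/(\int[Pr]_w (f \o U) w)%E -ge0_integral_distribution//.
rewrite -[RHS]fubini_tonelli1//; apply: eq_measure_integral => A mA _.
apply/esym/product_measure_unique => // C D mC mD; exact: XY.
Qed.

(** Unlike the preimages of sets under single coordinates, rectangles are closed under intersection,
    as uniqueness of measures requires of a generating class. *)
Lemma measurable_tuple_rectangles d (T : measurableType d) (n : nat) :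
  @measurable _ (n.-tuple T) = <<s [set [set u | forall i, C i (tnth u i)] |
    C in [set C : 'I_n -> set T | forall i, measurable (C i)]] >>.
Proof.
rewrite eqEsubset; split.
  apply: smallest_sub; first exact: smallest_sigma_algebra.
  move=> A; rewrite -bigcup_seq/= => -[i _ [B mB <-]].
  apply: sub_sigma_algebra; exists (fun j => if j == i then B else setT).
    by move=> j /=; case: ifP.
  apply/seteqP; split=> u /=.
    by move=> /(_ i); rewrite eqxx.
  by move=> [_ Bu] j; case: eqP => // ->.
apply: smallest_sub; first exact: sigma_algebra_measurable.
move=> _ [C mC <-].
have -> : [set u : n.-tuple T | forall i, C i (tnth u i)] =
    \bigcap_(i in [set: 'I_n]) ((fun u => tnth u i) @^-1` C i).
  by apply/seteqP; split=> u /= uC i; [move=> _|]; exact: uC.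
apply: fin_bigcap_measurable => // i _.
by rewrite -[X in measurable X]setTI; apply: measurable_tnth.
Qed.

Lemma measurable_mktuple d d' (T : measurableType d) (T' : measurableType d')
    (n : nat) (f : 'I_n -> T -> T') :
  (forall i, measurable_fun setT (f i)) ->
  measurable_fun setT (fun w => [tuple f i w | i < n]).
Proof.
move=> mf; apply/measurable_fun_tnthP => i.
by apply: (eq_measurable_fun (f i)) => // w _; rewrite /= tnth_mktuple.
Qed.

(** Freezing coordinate [k] at [z0] represents the other coordinates by a tuple of the same length.
    For fixed [A], both sides are finite measures in [B], so it suffices to compare them on
    rectangles. *)
Lemma coordinate_independent d d' (T : measurableType d)
    (T' : measurableType d') (R : realType) (Pr : probability T R) (n : nat)
    (Z : 'I_n -> {RV Pr >-> T'}) (k : 'I_n) (z0 : T') :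
  mutually_independent Pr (fun i => Z i : T -> T') ->
  independent Pr (Z k : T -> T')
    (fun w => [tuple if i == k then z0 else Z i w | i < n]).
Proof.
move=> indZ A B mA mB; set W := fun w : T => _.
have mW : measurable_fun setT W.
  by apply: measurable_mktuple => i; case: (i == k).
have mZ i C : measurable C -> measurable (Z i @^-1` C).
  by move=> mC; rewrite -[X in measurable X]setTI; apply: measurable_funP.
have p0 : 0 <= fine (Pr (Z k @^-1` A)) by exact: fine_ge0.
pose m1 := measure_function_pushforward__canonical__measure_function_Measure
  (mrestr Pr (mZ k A mA)) mW.
pose m2 := mscale (NngNum p0)
  (measure_function_pushforward__canonical__measure_function_Measure Pr mW).
suff: m1 B = m2 B.
  rewrite /m1 /m2 /= /mscale/= /pushforward /mrestr setIC => ->.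
  by rewrite fineK// fin_num_measure//; exact: (mZ k A mA).
apply: (measure_unique _ (fun=> setT) (measurable_tuple_rectangles T' n)) => //.
- move=> _ _ [C mC <-] [D mD <-]; exists (fun i => C i `&` D i).
    by move=> i; apply: measurableI.
  apply/seteqP; split=> u /=; first by move=> uCD; split=> i; have [] := uCD i.
  by move=> [uC uD] i; split.
- by move=> _; exists (fun=> setT) => //; apply/seteqP; split.
- by rewrite bigcup_const.
- move=> _ [C mC <-].
  rewrite /m1 /m2 /= /mscale/= /pushforward /mrestr fineK; last first.
    by rewrite fin_num_measure//; exact: (mZ k A mA).
  (* The constraint at [k] bears on the constant [z0]: either it fails and both sides vanish, or it
     is void and mutual independence applies to the remaining indices. *)
  have [Ck|nCk] := pselect (C k z0); last first.
    have -> : W @^-1` [set u | forall i, C i (tnth u i)] = set0.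
      by apply/seteqP; split=> w //= /(_ k); rewrite tnth_mktuple eqxx.
    by rewrite set0I measure0 mule0.
  have WE : W @^-1` [set u | forall i, C i (tnth u i)] =
      \bigcap_(i in [set` ~: [set k]%SET]) (Z i @^-1` C i).
    apply/seteqP; split=> w /= Cw i.
      by rewrite /= !inE => /negbTE ik; have := Cw i; rewrite tnth_mktuple ik.
    by rewrite tnth_mktuple; case: eqP => [->//|/eqP ik]; apply: Cw; rewrite /= !inE.
  (* The void constraint at [k] is replaced by the one on [Z k]. *)
  pose D i := if i == k then A else C i.
  have mD i : measurable (D i) by rewrite /D; case: ifP.
  have -> : W @^-1` [set u | forall i, C i (tnth u i)] `&` Z k @^-1` A =
      \bigcap_(i in [set` [set: 'I_n]%SET]) (Z i @^-1` D i).
    rewrite WE; apply/seteqP; split=> w /=.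
      move=> [Cw Aw] i _; rewrite /D/=; case: eqP => [->//|/eqP ik].
      by apply: Cw; rewrite /= !inE.
    move=> Dw; split; last by have := Dw k; rewrite /D eqxx; apply; rewrite /= inE.
    move=> i; rewrite /= !inE => /negbTE ik.
    by have := Dw i; rewrite /D ik; apply; rewrite /= inE.
  rewrite WE indZ// indZ// (bigD1 k) ?inE//=.
  have -> : D k = A by rewrite /D eqxx.
  congr (_ * _)%E; apply: eq_big => [i|i /andP[_ /negbTE ik]].
    by rewrite !inE.
  by rewrite /D ik.
- move=> _; rewrite -[m1 _]/(Pr (W @^-1` setT `&` Z k @^-1` A)).
  rewrite preimage_setT setTI -ge0_fin_numE//.
  by apply: fin_num_measure; exact: (mZ k A mA).
Qed.

(** * The two-point bound for Gaussian noise *)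

(** For [|x| <= sigma (1 + Delta)] the Gaussian exponent is at most
    [(1 + Delta)^2 / 2 <= 1 + Delta^2]. This interval contains [[-sigma, sigma]] and its translate
    by [- Delta * sigma]. *)
Lemma normal_prob_minorized (R : realType) (sigma Delta : R) (A : set R) :
  0 < sigma -> 0 <= Delta -> measurable A ->
  ((normal_peak 1 * expR (- 1 - Delta ^+ 2) / sigma)%:E *
    lebesgue_measure (A `&` `[(- (sigma * (1 + Delta)))%R,
                              (sigma * (1 + Delta))%R]) <=
   normal_prob 0 sigma A)%E.
Proof.
move=> s0 D0 mA; apply: integral_minorized => //.
- exact: measurable_normal_pdf.
- by move=> x; exact: normal_pdf_ge0.
- by rewrite divr_ge0 ?(ltW s0)// mulr_ge0 ?normal_peak_ge0 ?expR_ge0.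
move=> x /andP[x1 x2]; rewrite normal_pdfE ?gt_eqF//.
have -> : normal_peak sigma = normal_peak 1 / sigma.
  rewrite /normal_peak expr1n mul1r -mulrnAr sqrtrM ?sqr_ge0// sqrtr_sqr.
  by rewrite gtr0_norm// invfM mulrC.
rewrite mulrAC ler_wpM2l//.
  by rewrite divr_ge0 ?(ltW s0)// normal_peak_ge0.
rewrite ler_expR subr0 ler_pdivlMr; last by rewrite pmulrn_lgt0// exprn_gt0.
have : x ^+ 2 <= (sigma * (1 + Delta)) ^+ 2.
  rewrite -[leLHS]real_normK ?num_real//; apply: lerXn2r; rewrite ?nnegrE//.
    by rewrite mulr_ge0 ?(ltW s0)// addr_ge0.
  by rewrite ler_norml x1.
have : 0 <= (sigma * (1 - Delta)) ^+ 2 by exact: sqr_ge0.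
by rewrite mulr2n; nra.
Qed.

(** Parallelogram identity: no estimate is close to both sources. *)
Lemma sqr_pair_ge (R : realFieldType) (d s t : R) :
  t ^+ 2 / 2 <= (d - s) ^+ 2 + (d - (s + t)) ^+ 2.
Proof. have : 0 <= (d - s + (d - (s + t))) ^+ 2 by exact: sqr_ge0. nra. Qed.

(* Le Cam's two-point argument: the sources [s] and [s + t] give the same
   channel output when the noise of the [k]-th channel use is translated by
   [- Delta * sigma]. *)
Lemma two_point_bound d (T : measurableType d) (R : realType)
    (Pr : probability T R) (n : nat) (S : {RV Pr >-> R}) (pS : R -> R)
    (a b m : R) (sigma : R) (Z : 'I_n -> {RV Pr >-> R})
    (x : R -> 'I_n -> R) (dec : n.-tuple R -> R) (k : 'I_n) (t Delta : R)
    (G : set R) :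
  has_density S pS -> 0 <= m -> (forall s, a <= s <= b -> m <= pS s) ->
  0 < sigma -> iid_gaussian_noise sigma Z ->
  independent Pr (S : T -> R) (fun w : T => [tuple Z i w | i < n]) ->
  (forall i, measurable_fun setT (x^~ i)) -> measurable_fun setT dec ->
  0 <= Delta -> measurable G ->
  (forall s, G s -> a <= s <= b /\ a <= s + t <= b) ->
  (forall s, G s -> forall i,
    x (s + t) i = x s i + if i == k then Delta * sigma else 0) ->
  ((m * normal_peak 1 * expR (- 1 - Delta ^+ 2) * t ^+ 2 / 2)%:E *
     lebesgue_measure G <=
   mse Pr S (fun w => dec [tuple (x (S w) i + Z i w)%R | i < n]))%E.
Proof.
move=> hS m0 hp s0 [indZ gaussZ] indSZ mx mdec D0 mG Gab xG.
pose W w := [tuple if i == k then 0 else Z i w | i < n].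
have mW : measurable_fun setT W.
  by apply: measurable_mktuple => i; case: (i == k).
pose fW := isMeasurableFun.Build _ _ _ _ _ mW.
pose Wr : {RV Pr >-> n.-tuple R} := HB.pack W fW.
have mZW : measurable_fun setT (fun w => (Z k w, W w)).
  by apply: measurable_fun_pair.
pose fZW := isMeasurableFun.Build _ _ _ _ _ mZW.
pose ZW : {RV Pr >-> (R * n.-tuple R)%type} :=
  HB.pack (fun w => (Z k w, W w)) fZW.
(* [phi] splits the noise vector into its [k]-th coordinate and the rest, and independence from the
   source survives a measurable map. *)
have indSZW : independent Pr S ZW.
  move=> C D mC mD.
  pose phi (u : n.-tuple R) :=
    (tnth u k, [tuple if i == k then 0 else tnth u i | i < n]).
  have mphi : measurable_fun setT phi.
    apply: measurable_fun_pair; first exact: measurable_tnth.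
    by apply: measurable_mktuple => i; case: (i == k) => //; exact: measurable_tnth.
  have phiE w : phi [tuple Z i w | i < n] = (Z k w, W w).
    rewrite /phi tnth_mktuple; congr pair; apply: eq_mktuple => i.
    by rewrite tnth_mktuple.
  have ZWE : ZW @^-1` D = (fun w => [tuple Z i w | i < n]) @^-1` (phi @^-1` D).
    by apply/seteqP; split=> w; rewrite /preimage/= phiE.
  by rewrite ZWE indSZ// -[X in measurable X]setTI; exact: mphi.
have indZW : independent Pr (Z k) Wr by exact: coordinate_independent.
pose h (s z : R) (u : n.-tuple R) : \bar R :=
  ((dec [tuple x s i + (if i == k then z else tnth u i) | i < n] - s) ^+ 2)%:E.
have mh : measurable_fun setT
    (fun p : R * (R * n.-tuple R) => h p.1 p.2.1 p.2.2).
  apply/measurable_EFinP; apply: measurable_funX; apply: measurable_funB => //.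
  apply: (measurableT_comp mdec); apply: measurable_mktuple => i.
  apply: measurable_funD; first exact: (measurableT_comp (mx i)).
  case: (i == k).
    exact: (measurableT_comp measurable_fst).
  apply: (measurableT_comp (@measurable_tnth _ _ _ i)).
  exact: (measurableT_comp measurable_snd).
have h0 s z u : (0 <= h s z u)%E by rewrite lee_fin sqr_ge0.
(* The mean squared error given the source [s]; [F s z] below is also conditioned on the value [z]
   of the [k]-th noise. *)
pose Psi s := (\int[distribution Pr ZW]_p h s p.1 p.2)%E.
have mPsi : measurable_fun setT Psi.
  by apply: (@measurable_fun_fubini_tonelli_F _ _ _ _ _ (distribution Pr ZW)
    (fun p => h p.1 p.2.1 p.2.2)).
have Psi0 s : (0 <= Psi s)%E by exact: integral_ge0.
have mseE : mse Pr S (fun w => dec [tuple x (S w) i + Z i w | i < n]) =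
    (\int[distribution Pr S]_s Psi s)%E.
  rewrite -(@integral_independent _ _ _ _ _ _ _ Pr S ZW _ indSZW mh)//.
  rewrite /mse unlock; apply: eq_integral => w _; rewrite /h/=.
  congr ((dec _ - _) ^+ 2)%:E; apply: eq_mktuple => i.
  by rewrite tnth_mktuple; case: eqP => [->|].
pose F s z := (\int[distribution Pr Wr]_u h s z u)%E.
have mhs s : measurable_fun setT (fun p : R * n.-tuple R => h s p.1 p.2).
  apply: (measurableT_comp mh (g := fun p => (s, p))).
  exact: measurable_fun_pair.
have PsiE s : Psi s = (\int[distribution Pr (Z k)]_z F s z)%E.
  rewrite /Psi ge0_integral_distribution//.
  by rewrite -(@integral_independent _ _ _ _ _ _ _ Pr (Z k) Wr _ indZW (mhs s)).
have mF s : measurable_fun setT (F s).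
  by apply: (@measurable_fun_fubini_tonelli_F _ _ _ _ _ (distribution Pr Wr)
    (fun p => h s p.1 p.2)).
have F0 s z : (0 <= F s z)%E by exact: integral_ge0.
have mhsz s z : measurable_fun setT (h s z).
  apply: (measurableT_comp (mhs s) (g := fun u => (z, u))).
  exact: measurable_fun_pair.
set q := normal_peak 1 * expR (- 1 - Delta ^+ 2).
have q0 : 0 <= q by rewrite mulr_ge0 ?normal_peak_ge0 ?expR_ge0.
(* The pairs [(s, z)] and [(s + t, z - Delta * sigma)] yield the same channel output, hence the same
   estimate. *)
have FG s z : G s ->
    ((t ^+ 2 / 2)%:E <= F s z + F (s + t)%R (z - Delta * sigma)%R)%E.
  move=> Gs; rewrite -ge0_integralD//.
  rewrite -[leLHS]mule1 -(@probability_setT _ _ _ (distribution Pr Wr)).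
  rewrite -integral_cst//; apply: ge0_le_integral => //.
  - by move=> u _; rewrite lee_fin divr_ge0 ?sqr_ge0.
  - exact: emeasurable_funD.
  - move=> u _; rewrite /h -EFinD lee_fin.
    set y := [tuple x s i + _ | i < n]; set y' := [tuple x (s + t) i + _ | i < n].
    have -> : y' = y.
      by apply: eq_mktuple => i; rewrite xG//; case: (i == k); ring.
    exact: sqr_pair_ge.
(* Averaging over [z] in [[-sigma, sigma]]: its length [2 sigma] cancels the [1 / sigma] of the
   Gaussian density. *)
have PsiG s : G s -> ((q * t ^+ 2)%:E <= Psi s + Psi (s + t)%R)%E.
  move=> Gs; rewrite !PsiE.
  have := @shifted_pair_integral_ge R
    (distribution Pr (Z k)) (q / sigma)
    (- (Delta * sigma)) (t ^+ 2 / 2) `[- sigma, sigma]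
    `[- (sigma * (1 + Delta)), sigma * (1 + Delta)] (F s) (F (s + t)).
  move=> /(_ _ _ _ _ _ _ (mF _) (F0 _) (mF _) (F0 _) (fun z _ => FG s z Gs)).
  have -> : lebesgue_measure (`[- sigma, sigma] : set R) = (sigma + sigma)%:E.
    by rewrite lebesgue_measure_itv/= lte_fin gtrN// -EFinB opprK.
  rewrite -EFinM.
  have -> : q / sigma * (t ^+ 2 / 2) * (sigma + sigma) = q * t ^+ 2.
    by field; rewrite gt_eqF.
  apply => //.
  - by rewrite divr_ge0 ?(ltW s0).
  - by rewrite divr_ge0 ?sqr_ge0.
  - move=> z; rewrite /= !in_itv/= => /andP[z1 z2].
    have : 0 <= sigma * Delta by rewrite mulr_ge0 ?(ltW s0).
    by split; apply/andP; split; lra.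
  - move=> C mC; rewrite -[leRHS]/(distribution Pr (Z k) C) gaussZ//.
    exact: normal_prob_minorized.
rewrite mseE.
(* Now the translation acts on the source. Both integrands are [Psi], so the bound is on twice the
   error, whence the final factor 1/2. *)
have := @shifted_pair_integral_ge R
    (distribution Pr S) m t (q * t ^+ 2)
  G `[a, b] Psi Psi m0.
move=> /(_ _ mG _ _ (density_minorized hS m0 hp) mPsi Psi0 mPsi Psi0 PsiG).
have -> : m * normal_peak 1 * expR (- 1 - Delta ^+ 2) * t ^+ 2 / 2 =
    2^-1 * (m * (q * t ^+ 2)) by rewrite /q; field.
move=> bound; rewrite EFinM -muleA lee_pdivrMl// mule_natl mule2n; apply: bound.
- by rewrite mulr_ge0 ?sqr_ge0.
- exact: measurable_itv.
- by move=> s /Gab[? ?]; rewrite /= !in_itv.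
Qed.

(** * Effect of the fine and the coarse source shifts on the channel inputs *)

Lemma nearest_int_eq (R : realType) (x y : R) :
  - 2^-1 <= y - (nearest_int x)%:~R < 2^-1 -> nearest_int y = nearest_int x.
Proof.
by move=> /andP[? ?]; apply/eqP/nearest_intP; apply/andP; split; lra.
Qed.

(** Each encoding step multiplies the shift by [beta], and up to step [N] it stays at most 1/4. As
    the residuals are below 1/4 on the slack set, the shifted ones remain below 1/2 and no rounding
    changes. *)
Lemma residual_fine_shift (R : realType) (beta a b s t : R) (N i : nat) :
  1 <= beta -> 0 <= t -> beta ^+ N * t <= 4^-1 -> slack_set beta a b N s ->
  (i <= N)%N ->
  residual beta (s + t) i = residual beta s i + beta ^+ i * t /\
  ((i < N)%N -> nearest_int (beta * residual beta (s + t) i) =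
                nearest_int (beta * residual beta s i)).
Proof.
move=> b1 t0 tN sN; have b0 : 0 < beta by rewrite (lt_le_trans ltr01).
have near_eq j : (j < N)%N ->
    residual beta (s + t) j = residual beta s j + beta ^+ j * t ->
    nearest_int (beta * residual beta (s + t) j) =
    nearest_int (beta * residual beta s j).
  move=> jN ->; apply: nearest_int_eq; rewrite mulrDr mulrA -exprS addrAC.
  rewrite -residualS//.
  have := slack_set_residual sN jN.
  have /andP[+ _] := residualS_itv s j b0.
  have : 0 <= beta ^+ j.+1 * t by rewrite mulr_ge0// exprn_ge0// ltW.
  have : beta ^+ j.+1 * t <= 4^-1.
    by apply: le_trans tN; rewrite ler_wpM2r// ler_weXn2l.
  by move=> ? ? ? ?; apply/andP; split; lra.
elim: i => [|i IHi] iN.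
  have e0 : residual beta (s + t) 0 = residual beta s 0 + beta ^+ 0 * t.
    by rewrite mul1r.
  by split=> // ?; exact: near_eq.
have [ei /(_ iN) ni] := IHi (ltnW iN).
have eS : residual beta (s + t) i.+1 = residual beta s i.+1 + beta ^+ i.+1 * t.
  by rewrite !residualS// ni ei exprS; ring.
by split=> // ?; exact: near_eq.
Qed.

Lemma channel_input_fine_shift (R : realType) (n : nat)
    (P varS delta varE beta a b s t : R) (k i : 'I_n) :
  1 <= beta -> 0 <= t -> beta ^+ n.-1 * t <= 4^-1 ->
  slack_set beta a b n.-1 s -> k.+1 = n ->
  channel_input n P varS delta varE beta (s + t) i.+1 =
  channel_input n P varS delta varE beta s i.+1 +
    if i == k then Num.sqrt (P / varE) * (beta ^+ n.-1 * t) else 0.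
Proof.
move=> b1 t0 tn sn kn; rewrite /channel_input.
have -> : (i == k) = (i.+1 == n) by have := eqSS i k; rewrite kn => ->.
have shift j : (j <= n.-1)%N -> _ := @residual_fine_shift R beta a b s t n.-1 j
  b1 t0 tn sn.
case: eqP => [_|/eqP ni]; first by have [-> _] := shift _ (leqnn _); ring.
have iN : (i < n.-1)%N by have := ltn_ord i; move: ni; lia.
have [_ /(_ iN) ni'] := shift i (ltnW iN).
by rewrite /quantized /quantize /= ni' addr0.
Qed.

(** The quantizer commutes with translations along its own grid of step [1 / beta]. So [Q_1] absorbs
    the whole shift and [E_1], with all that follows, is unchanged. *)
Lemma quantize_coarse_shift (R : realType) (beta s : R) (m : nat) :
  0 < beta -> quantize beta (s + m%:R / beta) = quantize beta s + m%:R / beta.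
Proof.
move=> b0; rewrite /quantize mulrDr.
have -> : beta * (m%:R / beta) = (m%:Z)%:~R by rewrite mulrCA mulfV ?gt_eqF// mulr1.
by rewrite nearest_intDz intrD mulrDr [beta^-1 * (m%:Z)%:~R]mulrC.
Qed.

Lemma residual_coarse_shift (R : realType) (beta s : R) (m i : nat) :
  0 < beta -> residual beta (s + m%:R / beta) i.+1 = residual beta s i.+1.
Proof.
move=> b0; elim: i => [|i IHi]; last by rewrite residualS// IHi -residualS.
by rewrite /= quantize_coarse_shift//; ring.
Qed.

(** With [2 <= n] the first channel use carries [Q_1], the only affected quantity. *)
Lemma channel_input_coarse_shift (R : realType) (n m : nat)
    (P varS delta varE beta s : R) (k i : 'I_n) :
  (2 <= n)%N -> 0 < beta -> k = 0%N :> nat ->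
  channel_input n P varS delta varE beta (s + m%:R / beta) i.+1 =
  channel_input n P varS delta varE beta s i.+1 +
    if i == k then Num.sqrt (P / (varS + delta)) * (m%:R / beta) else 0.
Proof.
move=> n2 b0 k0; rewrite /channel_input.
have -> : (i == k) = ((i : nat) == 0%N) by rewrite -k0.
case: n n2 k i k0 => [|[|n]]// _ k i k0.
rewrite [n.+2.-1]/=.
have [i0|i0] := eqVneq (i : nat) 0%N.
  by rewrite i0 /= /quantized /= quantize_coarse_shift//; ring.
rewrite addr0; case: ifP => _; first by rewrite residual_coarse_shift.
rewrite /quantized [i.+1.-1]/=; case: (i : nat) i0 => [//|j _].
by rewrite residual_coarse_shift.
Qed.

Lemma channel_mse_ge d (T : measurableType d) (R : realType)
    (Pr : probability T R) (n : nat) (S : {RV Pr >-> R}) (pS : R -> R)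
    (a b m P delta beta sigma : R) (Z : 'I_n -> {RV Pr >-> R})
    (dec : n.-tuple R -> R) (k : 'I_n) (t u : R) (G : set R) :
  let varS := fine 'V_Pr[S]%E in
  let varE := fine 'V_Pr[fun w => residual beta (S w) n.-1]%E in
  has_density S pS -> 0 <= m -> (forall s, a <= s <= b -> m <= pS s) ->
  0 < sigma -> iid_gaussian_noise sigma Z ->
  independent Pr (S : T -> R) (fun w : T => [tuple Z i w | i < n]) ->
  measurable_fun setT dec -> 0 <= u -> measurable G ->
  (forall s, G s -> a <= s <= b /\ a <= s + t <= b) ->
  (forall s, G s -> forall i : 'I_n,
    channel_input n P varS delta varE beta (s + t) i.+1 =
    channel_input n P varS delta varE beta s i.+1 + if i == k then u else 0) ->
  ((m * normal_peak 1 * expR (- 1 - (u / sigma) ^+ 2) * t ^+ 2 / 2)%:E *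
     lebesgue_measure G <=
   mse Pr S (fun w => dec (channel_output S P delta beta Z w)))%E.
Proof.
move=> varS varE hS m0 hp s0 iidZ indSZ mdec u0 mG Gab uG.
apply: (@two_point_bound _ _ _ _ _ S pS a b m sigma Z
  (fun s i => channel_input n P varS delta varE beta s i.+1) dec k t) => //.
- move=> i; rewrite /channel_input; case: eqP => _; apply: measurable_funM => //.
    exact: measurable_residual.
  exact: measurable_quantized.
- by rewrite divr_ge0// ltW.
- by move=> s Gs i; rewrite uG// divfK// gt_eqF.
Qed.

(** * Growth rates in the two regimes of [beta] *)

Lemma fine_rate (R : realType) (N : nat) (snr beta K c v : R) :
  0 < snr -> 0 < ln snr -> 0 < beta -> 0 < K -> 0 <= c -> 0 <= v ->
  beta ^+ 2 <= K * snr / ln snr ->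
  c * v / K ^+ N * (snr ^- N.+1 * ln snr ^+ N) <=
  c * (Num.sqrt (v / snr) / beta ^+ N) ^+ 2.
Proof.
move=> s0 l0 b0 K0 c0 v0 bK.
rewrite expr_div_n sqr_sqrtr; last by rewrite divr_ge0// ltW.
have -> : c * v / K ^+ N * (snr ^- N.+1 * ln snr ^+ N) =
    c * (v / snr / (K * snr / ln snr) ^+ N).
  rewrite expr_div_n exprMn exprSr; field.
  by rewrite !expf_neq0 ?gt_eqF.
rewrite ler_wpM2l// ler_wpM2l//; first by rewrite divr_ge0// ltW.
rewrite lef_pV2 ?posrE ?exprn_gt0 ?divr_gt0 ?mulr_gt0//.
by rewrite exprAC lerXn2r ?nnegrE ?exprn_ge0// ?divr_ge0 ?mulr_ge0// ltW.
Qed.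

(** Multiplying [t] by the root of [snr] gives [snr * t^2 <= 2 + 2 * snr / beta^2]. The threshold
    [4 / v] is chosen so that the last term, divided by [v], is at most [ln snr / 2]. *)
Lemma coarse_shift_exponent (R : realType) (snr beta t v : R) :
  0 < snr -> 0 < ln snr -> 0 < beta -> 0 < v -> 0 <= t ->
  t <= (Num.sqrt snr)^-1 + beta^-1 -> 4 / v * snr / ln snr < beta ^+ 2 ->
  snr * t ^+ 2 / v <= 2 / v + ln snr / 2.
Proof.
move=> s0 l0 b0 v0 t0 tup bK; set r := Num.sqrt snr in tup.
have r0 : 0 < r by rewrite sqrtr_gt0.
have r2 : r ^+ 2 = snr by rewrite sqr_sqrtr// ltW.
have rt : 0 <= r * t by rewrite mulr_ge0// ltW.
have rt_le : r * t <= 1 + r / beta.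
  by rewrite -ler_pdivlMl// mulrDr mulr1 mulrA mulVf ?gt_eqF// mul1r.
have rb : (r / beta) ^+ 2 <= ln snr * v / 4.
  rewrite expr_div_n r2 ler_pdivrMr ?exprn_gt0//.
  move: bK; rewrite ltr_pdivrMr// => /ltW bK.
  have -> : snr = 4 / v * snr * (v / 4) by field; rewrite gt_eqF.
  have -> : ln (4 / v * snr * (v / 4)) = ln snr.
    by congr ln; field; rewrite gt_eqF.
  have -> : ln snr * v / 4 * beta ^+ 2 = beta ^+ 2 * ln snr * (v / 4) by ring.
  by rewrite ler_wpM2r// divr_ge0// ltW.
rewrite ler_pdivrMr//.
have -> : (2 / v + ln snr / 2) * v = 2 + 2 * (ln snr * v / 4).
  by field; rewrite gt_eqF.
have st : snr * t ^+ 2 <= (1 + r / beta) ^+ 2.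
  by rewrite -r2 -exprMn lerXn2r// nnegrE// (le_trans rt).
have : 0 <= (1 - r / beta) ^+ 2 by exact: sqr_ge0.
by move: (r / beta) rb st => y; rewrite !expr2; lra.
Qed.

(** The right side has order at least [snr^(-3/2)], because the exponential costs at most a factor
    [snr^(-1/2)] and [t^2 >= 1 / snr]. The target is at most [snr^(-2) * ln snr], and [ln snr / 2]
    is at most the root of [snr]; this last 2 is the 2 in the constant. *)
Lemma coarse_rate (R : realType) (N : nat) (snr t c w D : R) :
  (0 < N)%N -> 0 < snr -> 0 < ln snr -> 0 <= c -> 1 <= snr * t ^+ 2 ->
  D <= w + ln snr / 2 ->
  c * expR (- 1 - w) / 2 * (snr ^- N.+1 * ln snr ^+ N) <=
  c * expR (- 1 - D) * t ^+ 2.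
Proof.
case: N => // N _ s0 l0 c0 st Dw.
set L := ln snr in l0 Dw *.
have sL : snr = expR L by rewrite lnK ?posrE.
have Ls : L <= snr by rewrite sL; apply: le_trans (expR_ge1Dx L); lra.
have Lh : L / 2 <= expR (L / 2) by apply: le_trans (expR_ge1Dx _); lra.
have snrE : snr = expR (L / 2) ^+ 2 by rewrite sL expr2 -expRD; congr expR; lra.
(* Reduction to the exponent 1 of the logarithm: the surplus factor is a power of [L / snr <= 1]. *)
apply: (@le_trans _ _ (c * expR (- 1 - w) / 2 * (snr ^- 2 * L))).
  apply: ler_wpM2l; first by rewrite divr_ge0 ?mulr_ge0 ?expR_ge0.
  have -> : snr ^- N.+2 * L ^+ N.+1 = snr ^- 2 * L * (L / snr) ^+ N.
    rewrite expr_div_n !exprS; field.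
    by rewrite !expf_neq0 ?gt_eqF.
  rewrite ler_piMr ?mulr_ge0 ?invr_ge0 ?exprn_ge0 ?(ltW l0) ?(ltW s0)//.
  by rewrite exprn_ile1 ?divr_ge0 ?(ltW l0) ?(ltW s0)// ler_pdivrMr// mul1r.
have tlb : snr^-1 <= t ^+ 2 by rewrite -[leLHS]mul1r ler_pdivrMr// mulrC.
apply: (@le_trans _ _ (c * expR (- 1 - w - L / 2) * snr^-1)); last first.
  apply: ler_pM => //.
  - by rewrite mulr_ge0 ?expR_ge0.
  - by rewrite invr_ge0 ltW.
  - by rewrite ler_wpM2l// ler_expR; lra.
rewrite (expRD (- 1 - w)) (expRN (L / 2)).
set e := expR (L / 2) in Lh snrE *.
have e0 : 0 < e by exact: expR_gt0.
have -> : c * expR (- 1 - w) / 2 * (snr ^- 2 * L) =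
    c * expR (- 1 - w) * (snr^-1 * (snr^-1 * (L / 2))).
  by field; rewrite gt_eqF.
have -> : c * (expR (- 1 - w) / e) / snr =
    c * expR (- 1 - w) * (snr^-1 * e^-1).
  by field; rewrite !gt_eqF.
rewrite ler_wpM2l ?mulr_ge0 ?expR_ge0//.
rewrite ler_wpM2l ?invr_ge0 ?(ltW s0)//.
by rewrite mulrC ler_pdivrMr// snrE expr2 mulrA mulVf ?gt_eqF// mul1r.
Qed.

(** * Choice of the shifts and constants in the two regimes *)

Theorem theorem7 (R : realType) (d : measure_display) (T : measurableType d)
    (Pr : probability T R) (n : nat) (hn : (2 <= n)%N)
    (delta : R) (hdelta : 0 < delta)
    (S : {RV Pr >-> R})
    (hS1 : (S : T -> R) \in Lfun Pr 1%E) (hS2 : ('V_Pr[S] < +oo)%E)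
    (pS : R -> R) (hpS : has_density S pS)
    (A B pmin : R) (hAB : A < B) (hpmin : 0 < pmin)
    (hpAB : forall s : R, A <= s <= B -> pmin <= pS s)
    (P sigmaZ : R -> R)
    (hP : forall snr : R, 0 < snr -> 0 < P snr)
    (hsigmaZ : forall snr : R, 0 < snr -> 0 < sigmaZ snr)
    (hsnr : forall snr : R, 0 < snr -> P snr / sigmaZ snr ^+ 2 = snr)
    (Z : R -> 'I_n -> {RV Pr >-> R})
    (hZ : forall snr : R, 0 < snr -> iid_gaussian_noise (sigmaZ snr) (Z snr))
    (hSZ : forall snr : R, 0 < snr ->
       independent Pr (S : T -> R) (fun w : T => [tuple Z snr i w | i < n]))
    (beta : R -> R)
    (hbeta : forall snr : R, 0 < snr -> 0 < beta snr)
    (hbeta_oo : beta snr @[snr --> +oo] --> +oo)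
    (decoder : R -> n.-tuple R -> R)
    (hdecoder : forall snr : R, 0 < snr ->
       measurable_fun setT (decoder snr)) :
  in_Omega
    (fun snr : R =>
       mse Pr S (fun w : T => decoder snr
         (channel_output S (P snr) delta (beta snr) (Z snr) w)))
    (fun snr : R => snr ^- n * ln snr ^+ n.-1).
Proof.
set N := n.-1; have nE : n = N.+1 by rewrite /N; lia.
have N0 : (0 < N)%N by rewrite /N; lia.
(* Sources are taken in the left half of the interval, which leaves room for a shift by up to
   [(B - A) / 2]. *)
pose M := (A + B) / 2.
have ME : M = (A + B) / 2 by [].
have AM : A < M by lra.
have shiftAB s t : A <= s < M -> 0 <= t -> t <= (B - A) / 2 ->
    A <= s <= B /\ A <= s + t <= B.
  by move=> /andP[? ?] ? ?; split; apply/andP; split; lra.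
have half_AB x : x <= (B - A) / 4 -> x <= (B - A) / 2 by move=> ?; lra.
have sum_AB x y : x <= (B - A) / 4 -> y <= (B - A) / 4 -> x + y <= (B - A) / 2.
  by move=> ? ?; lra.
have [v0 [K1 [v00 varP]]] :=
  variance_residual_ge n.-2 hpS hAB hpmin hpAB.
have nE2 : n.-2.+1 = n.-1 by lia.
rewrite nE2 in varP.
have [cG [K2 [cG0 GP]]] := slack_set_measure_ge n.-1 AM.
pose v := fine 'V_Pr[S]%E + delta.
have v_gt0 : 0 < v by rewrite ltr_wpDl// fine_ge0// variance_ge0.
pose K := 4 / v.
have K0 : 0 < K by rewrite divr_gt0.
pose q := pmin * normal_peak 1.
have q0 : 0 < q by rewrite mulr_gt0// normal_peak_gt0.
(* In [c1] the factor [expR (- 2)] is the exponential for [Delta = 1], and [cG] measures the slack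
   set; in [c2] the sources fill [[A, M[]. *)
pose c1 := q * expR (- 2) / 2 * cG.
pose c2 := q / 2 * (M - A).
have c10 : 0 < c1 by rewrite mulr_gt0// divr_gt0// mulr_gt0// expR_gt0.
have c20 : 0 < c2 by rewrite /c2 mulr_gt0 ?subr_gt0// divr_gt0.
pose d1 := c1 * v0 / K ^+ N.
pose d2 := c2 * expR (- 1 - 2 / v) / 2.
have d10 : 0 < d1 by rewrite /d1 divr_gt0 ?exprn_gt0// mulr_gt0.
have d20 : 0 < d2 by rewrite /d2 divr_gt0// mulr_gt0// expR_gt0.
(* 1/4 is the slack of the rounding cells; [(B - A) / 4] keeps shifted sources inside [[A, B]]. *)
pose eps := Num.min 4^-1 ((B - A) / 4).
have eps0 : 0 < eps by rewrite lt_min invr_gt0 divr_gt0 ?subr_gt0//= ltr0n.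
suff [x0 [_ x0P]] : \forall snr \near +oo, (((Num.min d1 d2) *
    (snr ^- n * ln snr ^+ N))%:E <= mse Pr S (fun w => decoder snr
      (channel_output S (P snr) delta (beta snr) (Z snr) w)))%E.
  by exists x0, (Num.min d1 d2); split; first by rewrite lt_min d10.
near=> snr.
have snr_ge : expR 1 <= snr by near: snr; apply: nbhs_pinfty_ge; exact: num_real.
have s0 : 0 < snr by rewrite (lt_le_trans (expR_gt0 1)).
have l1 : 1 <= ln snr by rewrite -[leLHS]expRK ler_ln ?posrE ?expR_gt0.
have l0 : 0 < ln snr by rewrite (lt_le_trans ltr01).
have snr_v0 : v0 / eps ^+ 2 <= snr.
  by near: snr; apply: nbhs_pinfty_ge; exact: num_real.
have snr_1 : 1 / eps ^+ 2 <= snr.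
  by near: snr; apply: nbhs_pinfty_ge; exact: num_real.
have b1 : 1 <= beta snr by near: snr; move/cvgryPge : hbeta_oo; exact.
have b0 : 0 < beta snr by exact: hbeta.
have bK1 : K1 <= beta snr by near: snr; move/cvgryPge : hbeta_oo; exact.
have bK2 : K2 <= beta snr by near: snr; move/cvgryPge : hbeta_oo; exact.
have bAB : 4 / (B - A) <= beta snr.
  by near: snr; move/cvgryPge : hbeta_oo; exact.
have sqrt_le w : 0 <= w -> w / eps ^+ 2 <= snr -> Num.sqrt (w / snr) <= eps.
  move=> w0; rewrite ler_pdivrMr ?exprn_gt0// => wE.
  have -> : eps = Num.sqrt (eps ^+ 2) by rewrite sqrtr_sqr gtr0_norm.
  by rewrite ler_wsqrtr// ler_pdivrMr// mulrC.
have P0 := hP _ s0; have sig0 := hsigmaZ _ s0.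
pose E := fun w => residual (beta snr) (S w) n.-1.
have varE_ge : v0 <= fine 'V_Pr[E]%E by exact: varP.
have varE0 : 0 < fine 'V_Pr[E]%E by rewrite (lt_le_trans v00).
have [bK|bK] := lerP (beta snr ^+ 2) (K * snr / ln snr).
  pose h := Num.sqrt (v0 / snr).
  have h0 : 0 <= h by exact: sqrtr_ge0.
  have heps : h <= eps by apply: sqrt_le => //; exact: ltW.
  (* After amplification by [beta ^ N], the shift moves [E_(n-1)] by exactly [h]. *)
  pose t := h / beta snr ^+ N.
  have t0 : 0 <= t by rewrite divr_ge0// exprn_ge0// ltW.
  have bt : beta snr ^+ N * t = h by rewrite mulrC divfK// expf_neq0// gt_eqF.
  have th : t <= h by rewrite ler_pdivrMr ?exprn_gt0// ler_peMr// exprn_ege1.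
  have kN : (N < n)%N by rewrite nE.
  pose u := Num.sqrt (P snr / fine 'V_Pr[E]%E) * h.
  have u0 : 0 <= u by rewrite mulr_ge0 ?sqrtr_ge0.
  have [h1 h2] : h <= 4^-1 /\ h <= (B - A) / 4.
    by move: heps; rewrite le_min => /andP[].
  (* The squared displacement in noise units equals [v0] over the variance of [E_(n-1)]. *)
  have uE : (u / sigmaZ snr) ^+ 2 <= 1.
    rewrite expr_div_n exprMn !sqr_sqrtr ?divr_ge0 ?(ltW P0) ?(ltW s0)//;
      last 2 first.
    - exact: ltW.
    - exact: ltW.
    have -> : P snr / fine 'V_Pr[E]%E * (v0 / snr) / sigmaZ snr ^+ 2 =
        P snr / sigmaZ snr ^+ 2 * (v0 / (fine 'V_Pr[E]%E * snr)).
      by field; rewrite !gt_eqF.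
    rewrite hsnr// -[in X in X * _](mul1r snr).
    have -> : 1 * snr * (v0 / (fine 'V_Pr[E]%E * snr)) = v0 / fine 'V_Pr[E]%E.
      by field; rewrite !gt_eqF.
    by rewrite ler_pdivrMr// mul1r.
  have := @channel_mse_ge _ _ _ Pr n S pS A B pmin (P snr) delta (beta snr)
    (sigmaZ snr) (Z snr) (decoder snr) (Ordinal kN) t u
    (slack_set (beta snr) A M N) hpS (ltW hpmin) hpAB sig0 (hZ _ s0) (hSZ _ s0)
    (hdecoder _ s0) u0 (measurable_slack_set _ _ _ _).
  move=> bound; apply: le_trans (bound _ _); last 2 first.
  - move=> s /slack_set_itv sAM; apply: shiftAB => //.
    exact/(le_trans th)/half_AB.
  - move=> s Gs i; rewrite /u -bt; apply: channel_input_fine_shift => //.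
      by rewrite bt.
    exact: Gs.
  apply: (@le_trans _ _ ((q * expR (- 2) / 2 * t ^+ 2)%:E * cG%:E)%E).
    rewrite -EFinM lee_fin.
    have -> : q * expR (- 2) / 2 * t ^+ 2 * cG = c1 * t ^+ 2 by rewrite /c1; ring.
    apply: le_trans (fine_rate N s0 l0 b0 K0 (ltW c10) (ltW v00) bK).
    rewrite -nE ler_wpM2r ?ge_min ?lexx//.
    by rewrite mulr_ge0 ?invr_ge0 ?exprn_ge0// ltW.
  apply: (@le_trans _ _ ((q * expR (- 2) / 2 * t ^+ 2)%:E *
      lebesgue_measure (slack_set (beta snr) A M N))%E).
    rewrite lee_wpmul2l//; last exact: GP.
    by rewrite lee_fin mulr_ge0 ?sqr_ge0// divr_ge0// mulr_ge0 ?expR_ge0// ltW.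
  rewrite lee_wpmul2r// lee_fin mulrAC ler_wpM2r// ler_wpM2r ?sqr_ge0//.
  by rewrite ler_wpM2l ?(ltW q0)// ler_expR; lra.
(* The least integer above [beta / sqrt snr], so that [t] lies between [1 / sqrt snr] and
   [1 / sqrt snr + 1 / beta]. *)
pose m := (Num.truncn (beta snr / Num.sqrt snr)).+1.
pose t := m%:R / beta snr.
have ss0 : 0 < Num.sqrt snr by rewrite sqrtr_gt0.
have mlow : beta snr / Num.sqrt snr <= m%:R by exact/ltW/truncnS_gt.
have mup : m%:R <= beta snr / Num.sqrt snr + 1.
  by rewrite -natr1 lerD2r truncn_le divr_ge0// ltW.
have tlow : (Num.sqrt snr)^-1 <= t by rewrite ler_pdivlMr// mulrC.
have tup : t <= (Num.sqrt snr)^-1 + (beta snr)^-1.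
  by rewrite ler_pdivrMr// mulrDl mulVf ?gt_eqF// mulrC.
have t0 : 0 <= t by rewrite divr_ge0// ltW.
have sVeps : (Num.sqrt snr)^-1 <= (B - A) / 4.
  have : Num.sqrt (1 / snr) <= eps by exact: sqrt_le.
  by rewrite div1r sqrtrV ?(ltW s0)// le_min => /andP[].
have bVeps : (beta snr)^-1 <= (B - A) / 4.
  by rewrite -[leRHS]invrK lef_pV2 ?posrE ?invr_gt0 ?divr_gt0 ?subr_gt0// invf_div.
pose u := Num.sqrt (P snr / v) * t.
have u0 : 0 <= u by rewrite mulr_ge0 ?sqrtr_ge0.
have uE : (u / sigmaZ snr) ^+ 2 = snr * t ^+ 2 / v.
  rewrite expr_div_n exprMn sqr_sqrtr ?divr_ge0 ?(ltW P0) ?(ltW v_gt0)//.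
  by rewrite -[in RHS](hsnr _ s0); field; rewrite !gt_eqF.
have st1 : 1 <= snr * t ^+ 2.
  rewrite -[X in X * _](sqr_sqrtr (ltW s0)) -exprMn exprn_ege1//.
  by rewrite -ler_pdivrMl// mulr1.
have uD : (u / sigmaZ snr) ^+ 2 <= 2 / v + ln snr / 2.
  by rewrite uE; exact: (coarse_shift_exponent s0 l0 b0 v_gt0 t0 tup bK).
have k0 : (0 < n)%N by rewrite nE.
have := @channel_mse_ge _ _ _ Pr n S pS A B pmin (P snr) delta (beta snr)
  (sigmaZ snr) (Z snr) (decoder snr) (Ordinal k0) t u `[A, M[
  hpS (ltW hpmin) hpAB sig0 (hZ _ s0) (hSZ _ s0)
  (hdecoder _ s0) u0 (measurable_itv _).
move=> bound; apply: le_trans (bound _ _); last 2 first.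
- move=> s; rewrite /= in_itv/= => sAM; apply: shiftAB => //.
  exact/(le_trans tup)/sum_AB.
- by move=> s _ i; exact: channel_input_coarse_shift.
rewrite lebesgue_measure_itv/= lte_fin AM -EFinB -EFinM lee_fin.
apply: le_trans (_ : _ <= d2 * (snr ^- n * ln snr ^+ N)) _.
  rewrite ler_wpM2r ?ge_min ?lexx ?orbT//.
  by rewrite mulr_ge0 ?invr_ge0 ?exprn_ge0// ltW.
rewrite {1}nE; apply: le_trans (coarse_rate N0 s0 l0 (ltW c20) st1 uD) _.
by rewrite /c2 /q le_eqVlt; apply/orP; left; apply/eqP; field.
Unshelve. all: by end_near. Qed.
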